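(* Let $\mathcal V=\alpha_1+j\alpha_2=\nu_1e_1+\nu_2e_2\in\mathbb{BC}$ with $\alpha_1=\frac{l_1+l_2}{2}$ and $\alpha_2=\frac{l_2-l_1}{2i}$, where $l_1,l_2\in\mathbb N\cup\{0\}$. Then the bicomplex Bessel function $\mathcal J_{\mathcal V}(Z)$ is a (bicomplex) holomorphic function of $Z=z_1e_1+z_2e_2$ in the whole bicomplex space $\mathbb{BC}$.
   Context: Bicomplex numbers: $\mathbb{BC}=\{\lambda_1+j\lambda_2:\lambda_1,\lambda_2\in\mathbb C(i)\}$ with commuting units $i,j$, $i^2=j^2=-1$, $k=ij$, $k^2=1$. Put $e_1=\frac{1+k}{2}$, $e_2=\frac{1-k}{2}$; then $e_1+e_2=1$, $e_l^2=e_l$, $e_1e_2=0$. Every $Z=\lambda_1+j\lambda_2$ has the unique idempotent representation $Z=z_1e_1+z_2e_2$ with $z_1=\lambda_1-i\lambda_2$, $z_2=\lambda_1+i\lambda_2\in\mathbb C(i)$ (so here $\nu_1=l_1$, $\nu_2=l_2$). The set of zero divisors is $\mathcal O_2=\{\lambda_1+j\lambda_2:\lambda_1^2+\lambda_2^2=0\}=\{Z: z_1z_2=0\}$. A function $g:X\subset\mathbb{BC}\to\mathbb{BC}$ is differentiable at $Z_0$ if $\lim_{Z\to Z_0,\ Z-Z_0\notin\mathcal O_2}\frac{g(Z)-g(Z_0)}{Z-Z_0}$ exists finitely, and bicomplex holomorphic in $X$ if it is differentiable at every point of $X$. Equivalently, writing $g=g_1+jg_2$ as a function of $Z=\lambda_1+j\lambda_2$,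 $g_1,g_2$ are holomorphic in $(\lambda_1,\lambda_2)$ and $\frac{\partial g_1}{\partial\lambda_1}=\frac{\partial g_2}{\partial\lambda_2}$, $\frac{\partial g_1}{\partial\lambda_2}=-\frac{\partial g_2}{\partial\lambda_1}$. Powers and Gamma: $Z^{\mathcal V}=z_1^{\nu_1}e_1+z_2^{\nu_2}e_2$; $\Gamma_b(Z)=\Gamma(z_1)e_1+\Gamma(z_2)e_2$. Bicomplex Bessel function: for $\mathcal V,Z\in\mathbb{BC}$, $$\mathcal J_{\mathcal V}(Z)=\sum_{s=0}^\infty\frac{(-1)^s}{\Gamma_b(\mathcal V+s+1)s!}\left(\frac Z2\right)^{\mathcal V+2s},$$ equivalently $\mathcal J_{\mathcal V}(Z)=J_{\nu_1}(z_1)e_1+J_{\nu_2}(z_2)e_2$ with $J_\nu$ the classical Bessel function of the first kind. *)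

(* Defs.v *)
Set Warnings "-notation-overridden,-notation-incompatible-prefix,-ambiguous-paths,-redundant-canonical-projection".
From HB Require Import structures.
From mathcomp Require Import all_boot all_order all_algebra.
From mathcomp Require Import all_classical all_reals all_analysis.
From mathcomp Require Import complex ring.

Set Implicit Arguments.
Unset Strict Implicit.
Unset Printing Implicit Defensive.

Import Order.TTheory GRing.Theory Num.Theory numFieldNormedType.Exports.
Local Open Scope classical_set_scope.
Local Open Scope ring_scope.
Local Open Scope complex_scope.

Definition cexp (R : realType) (z : R[i]) : R[i] :=
  (expR (complex.Re z) * cos (complex.Im z)) +i* (expR (complex.Re z) * sin (complex.Im z)).

(* Principal argument, with values in ]-pi, pi] for z != 0. *)
Definition carg (R : realType) (z : R[i]) : R :=
  let t := acos (complex.Re z / Normc.normc z) in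
  if 0 <= complex.Im z then t else - t.

Definition clog (R : realType) (z : R[i]) : R[i] :=
  ln (Normc.normc z) +i* carg z.

(* Principal value of z ^ w, with 0 ^ 0 = 1 and 0 ^ w = 0 for w != 0. *)
Definition cpow (R : realType) (z w : R[i]) : R[i] :=
  if z == 0 then (w == 0)%:R else cexp (w * clog z).

(* Euler-Gauss form of the Gamma function on the complex plane:
     Gamma(z) = lim_n  n! n^z / (z (z + 1) ... (z + n)).
   The regular algebra R[i]^o is R[i] with its topology.  At the poles
   0, -1, -2, ... the terms are eventually 0 (as x / 0 = 0), so cgamma takes
   the value 0 there and (cgamma z)^-1 is the entire function 1 / Gamma. *)
Definition cgamma (R : realType) (z : R[i]) : R[i] :=
  lim ((fun n : nat => n`!%:R * cpow n%:R z
                       / \prod_(0 <= k < n.+1) (z + k%:R) : R[i]^o) @ \oo).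

(* (a, b) stands for a + j b, with a, b in C(i); the topology is the
   one of C^2.  The ring structure is NOT the componentwise one of pairs. *)
Definition bicomplex (R : realType) : Type := (R[i]^o * R[i]^o)%type.

HB.instance Definition _ (R : realType) :=
  NormedModule.copy (bicomplex R) (R[i]^o * R[i]^o)%type.

Section BicomplexRing.
Variable R : realType.
Implicit Types Z W : bicomplex R.

Definition bc (a b : R[i]) : bicomplex R := (a, b).
Definition bcl1 Z : R[i] := Z.1.
Definition bcl2 Z : R[i] := Z.2.

Lemma bcl1E (a b : R[i]) : bcl1 (bc a b) = a. Proof. by []. Qed.
Lemma bcl2E (a b : R[i]) : bcl2 (bc a b) = b. Proof. by []. Qed.

Lemma bicomplexP Z W : bcl1 Z = bcl1 W -> bcl2 Z = bcl2 W -> Z = W.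
Proof. by case: Z W => [a b] [c d]; rewrite /bcl1 /bcl2 /= => -> ->. Qed.

Definition bc1 : bicomplex R := bc 1 0.

(* (a + j b)(c + j d) = (a c - b d) + j (a d + b c) *)
Definition bcmul Z W : bicomplex R :=
  bc (bcl1 Z * bcl1 W - bcl2 Z * bcl2 W) (bcl1 Z * bcl2 W + bcl2 Z * bcl1 W).

Lemma bcl1D Z W : bcl1 (Z + W) = bcl1 Z + bcl1 W. Proof. by []. Qed.
Lemma bcl2D Z W : bcl2 (Z + W) = bcl2 Z + bcl2 W. Proof. by []. Qed.

Fact bcmulA : associative bcmul.
Proof. by move=> X Y Z; apply: bicomplexP; rewrite /bcl1 /bcl2 /=; ring. Qed.
Fact bcmulC : commutative bcmul.
Proof. by move=> X Y; apply: bicomplexP; rewrite /bcl1 /bcl2 /=; ring. Qed.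
Fact bcmul1 : left_id bc1 bcmul.
Proof. by move=> X; apply: bicomplexP; rewrite /bcl1 /bcl2 /=; ring. Qed.
Fact bcmulDl : left_distributive bcmul +%R.
Proof.
by move=> X Y Z; apply: bicomplexP; rewrite /bcmul /= ?bcl1D ?bcl2D /bcl1 /bcl2 /=; ring.
Qed.
Fact bc1_neq0 : bc1 != 0.
Proof. by apply/eqP => /(congr1 bcl1) /eqP; rewrite /bcl1 /= oner_eq0. Qed.

HB.instance Definition _ := GRing.Zmodule_isComNzRing.Build (bicomplex R)
  bcmulA bcmulC bcmul1 bcmulDl bc1_neq0.

Lemma bcl1M Z W : bcl1 (Z * W) = bcl1 Z * bcl1 W - bcl2 Z * bcl2 W.
Proof. by []. Qed.
Lemma bcl2M Z W : bcl2 (Z * W) = bcl1 Z * bcl2 W + bcl2 Z * bcl1 W.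
Proof. by []. Qed.

Lemma bcl1N Z : bcl1 (- Z) = - bcl1 Z. Proof. by []. Qed.
Lemma bcl2N Z : bcl2 (- Z) = - bcl2 Z. Proof. by []. Qed.
Lemma bcl11 : bcl1 (1 : bicomplex R) = 1. Proof. by []. Qed.
Lemma bcl21 : bcl2 (1 : bicomplex R) = 0. Proof. by []. Qed.

Definition bcE := (bcl1D, bcl2D, bcl1M, bcl2M, bcl1N, bcl2N,
                   bcl11, bcl21, bcl1E, bcl2E).

(* l1^2 + l2^2 = (l1 - i l2)(l1 + i l2) *)
Definition bcnorm2 Z : R[i] := bcl1 Z ^+ 2 + bcl2 Z ^+ 2.

Definition bcunit : pred (bicomplex R) := fun Z => bcnorm2 Z != 0.

Definition bcinv Z : bicomplex R :=
  if bcunit Z then bc (bcl1 Z / bcnorm2 Z) (- bcl2 Z / bcnorm2 Z) else Z.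

Fact bcmulVx : {in bcunit, left_inverse 1 bcinv *%R}.
Proof.
move=> Z uZ; have nZ : bcnorm2 Z != 0 by [].
rewrite /bcinv (_ : bcunit Z = true) //; apply: bicomplexP.
  rewrite bcl1M /bcl1 /bcl2 /=; rewrite -/(bcl1 Z) -/(bcl2 Z).
  rewrite (_ : _ - _ = bcnorm2 Z / bcnorm2 Z); first by rewrite divff.
  by rewrite {3}/bcnorm2; ring.
rewrite bcl2M /bcl1 /bcl2 /=; rewrite -/(bcl1 Z) -/(bcl2 Z).
by rewrite (_ : _ + _ = 0) //; ring.
Qed.
Fact bcunitPl Z W : W * Z = 1 -> bcunit Z.
Proof.
move=> WZ; rewrite /bcunit; apply/eqP => nZ0.
have : bcnorm2 (W * Z) = bcnorm2 W * bcnorm2 Z.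
  by rewrite /bcnorm2 bcl1M bcl2M; ring.
rewrite WZ nZ0 mulr0 /bcnorm2 /bcl1 /bcl2 /= expr0n addr0 expr1n.
by move/eqP; rewrite oner_eq0.
Qed.
Fact bcinv_out : {in [predC bcunit], bcinv =1 id}.
Proof.
move=> Z; rewrite inE /= /bcinv => nuZ; case: ifP => // uZ.
by move: nuZ; rewrite /in_mem /= uZ.
Qed.

HB.instance Definition _ := GRing.ComNzRing_hasMulInverse.Build (bicomplex R)
  bcmulVx bcunitPl bcinv_out.

End BicomplexRing.

Definition bcC (R : realType) (a : R[i]) : bicomplex R := bc a 0.
Definition bcj (R : realType) : bicomplex R := bc 0 1.
Definition bck (R : realType) : bicomplex R := bcC 'i%R * bcj R.
Definition bce1 (R : realType) : bicomplex R := (1 + bck R) / 2.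
Definition bce2 (R : realType) : bicomplex R := (1 - bck R) / 2.
(* Components of Z in the idempotent basis: Z = z1 e1 + z2 e2 (bcidemK). *)
Definition bcz1 (R : realType) (Z : bicomplex R) : R[i] :=
  bcl1 Z - 'i%R * bcl2 Z.
Definition bcz2 (R : realType) (Z : bicomplex R) : R[i] :=
  bcl1 Z + 'i%R * bcl2 Z.
Definition bcidem (R : realType) (z1 z2 : R[i]) : bicomplex R :=
  bcC z1 * bce1 R + bcC z2 * bce2 R.

Section IdempotentTheory.
Variable R : realType.
Implicit Types Z W : bicomplex R.

Lemma bcjE (a b : R[i]) : bcC a + bcj R * bcC b = bc a b.
Proof. by apply: bicomplexP; rewrite !bcE; ring. Qed.

Lemma bcj2 : bcj R * bcj R = -1.
Proof. by apply: bicomplexP; rewrite !bcE; ring. Qed.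

Lemma bcC_half : (2 : bicomplex R)^-1 = bcC 2^-1.
Proof.
have H : (2 : bicomplex R) * bcC 2^-1 = 1.
  apply: bicomplexP; rewrite !bcE; last by ring.
  by field.
have uH : (2 : bicomplex R) \is a GRing.unit.
  by apply/unitrPr; exists (bcC 2^-1).
by apply: (mulrI uH); rewrite H divrr.
Qed.

Lemma bcz1M Z W : bcz1 (Z * W) = bcz1 Z * bcz1 W.
Proof.
rewrite /bcz1 !bcE; have : ('i%R : R[i]) ^+ 2 = -1 := sqrCi _.
set i := 'i%R => i2.
have -> : bcl1 Z * bcl1 W - bcl2 Z * bcl2 W
  = bcl1 Z * bcl1 W + i ^+ 2 * (bcl2 Z * bcl2 W) by rewrite i2; ring.
ring.
Qed.

Lemma bcz2M Z W : bcz2 (Z * W) = bcz2 Z * bcz2 W.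
Proof.
rewrite /bcz2 !bcE; have : ('i%R : R[i]) ^+ 2 = -1 := sqrCi _.
set i := 'i%R => i2.
have -> : bcl1 Z * bcl1 W - bcl2 Z * bcl2 W
  = bcl1 Z * bcl1 W + i ^+ 2 * (bcl2 Z * bcl2 W) by rewrite i2; ring.
ring.
Qed.

Lemma bcz1D Z W : bcz1 (Z + W) = bcz1 Z + bcz1 W.
Proof. by rewrite /bcz1 !bcE; ring. Qed.

Lemma bcz2D Z W : bcz2 (Z + W) = bcz2 Z + bcz2 W.
Proof. by rewrite /bcz2 !bcE; ring. Qed.

Lemma bc_neq0_i : ('i%R : R[i]) != 0.
Proof. exact: neq0Ci. Qed.

Lemma bcidemE (z1 z2 : R[i]) :
  bcidem z1 z2 = bc ((z1 + z2) / 2) ((z2 - z1) / (2 * 'i%R)).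
Proof.
have iV : ('i%R : R[i])^-1 = - 'i%R.
  by apply: (mulfI bc_neq0_i); rewrite divff ?bc_neq0_i// mulrN -expr2 sqrCi opprK.
rewrite invfM iV /bcidem /bce1 /bce2 /bck bcC_half.
by apply: bicomplexP; rewrite !bcE; ring.
Qed.

Lemma bcidem_z1 (z1 z2 : R[i]) : bcz1 (bcidem z1 z2) = z1.
Proof.
rewrite bcidemE /bcz1 !bcE; have := bc_neq0_i; set i := 'i%R => i0.
by field; rewrite i0.
Qed.

Lemma bcidem_z2 (z1 z2 : R[i]) : bcz2 (bcidem z1 z2) = z2.
Proof.
rewrite bcidemE /bcz2 !bcE; have := bc_neq0_i; set i := 'i%R => i0.
by field; rewrite i0.
Qed.

Lemma bcidemK Z : bcidem (bcz1 Z) (bcz2 Z) = Z.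
Proof.
rewrite bcidemE /bcz1 /bcz2; have := bc_neq0_i; set i := 'i%R => i0.
by apply: bicomplexP; rewrite !bcE; field; rewrite ?i0.
Qed.

Lemma bcnorm2E Z : bcnorm2 Z = bcz1 Z * bcz2 Z.
Proof.
rewrite /bcnorm2 /bcz1 /bcz2; have : ('i%R : R[i]) ^+ 2 = -1 := sqrCi _.
set i := 'i%R => i2.
rewrite (_ : _ * _ = bcl1 Z ^+ 2 - i ^+ 2 * bcl2 Z ^+ 2); last by ring.
by rewrite i2; ring.
Qed.

End IdempotentTheory.

Definition bc_zerodiv (R : realType) : set (bicomplex R) :=
  [set Z | bcl1 Z ^+ 2 + bcl2 Z ^+ 2 = 0].

(* g is total; only its values on X matter.  Division is that of the ring
   bicomplex R, genuine here since Z - Z0 is kept off the zero divisors. *)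
Definition bc_differentiable (R : realType) (X : set (bicomplex R))
    (g : bicomplex R -> bicomplex R) (Z0 : bicomplex R) : Prop :=
  exists L : bicomplex R,
    (g Z - g Z0) / (Z - Z0)
      @[Z --> within [set Z | X Z /\ ~ bc_zerodiv (Z - Z0)] (nbhs Z0)] --> L.

Definition bc_holomorphic (R : realType) (X : set (bicomplex R))
    (g : bicomplex R -> bicomplex R) : Prop :=
  forall Z0, X Z0 -> bc_differentiable X g Z0.

Definition bcpow (R : realType) (Z V : bicomplex R) : bicomplex R :=
  bcidem (cpow (bcz1 Z) (bcz1 V)) (cpow (bcz2 Z) (bcz2 V)).

Definition bcgamma (R : realType) (Z : bicomplex R) : bicomplex R :=
  bcidem (cgamma (bcz1 Z)) (cgamma (bcz2 Z)).

(* 1 / Gamma_b.  It is taken componentwise because the inverse of the ring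
   bicomplex R is the identity on zero divisors, whereas 1 / Gamma must vanish
   at the poles of Gamma; see bcrgammaE for the other points. *)
Definition bcrgamma (R : realType) (Z : bicomplex R) : bicomplex R :=
  bcidem (cgamma (bcz1 Z))^-1 (cgamma (bcz2 Z))^-1.

Lemma bcrgammaE (R : realType) (Z : bicomplex R) :
  bcgamma Z \is a GRing.unit -> bcrgamma Z = (bcgamma Z)^-1.
Proof.
move=> uG; apply: (mulrI uG); rewrite divrr//.
have : bcnorm2 (bcgamma Z) != 0 by exact: uG.
rewrite bcnorm2E bcidem_z1 bcidem_z2 mulf_eq0 negb_or => /andP[g1 g2].
have z11 : bcz1 (1 : bicomplex R) = 1 by rewrite /bcz1 !bcE; ring.
have z21 : bcz2 (1 : bicomplex R) = 1 by rewrite /bcz2 !bcE; ring.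
rewrite -[LHS]bcidemK -[RHS]bcidemK bcz1M bcz2M z11 z21.
by rewrite !bcidem_z1 !bcidem_z2 !divff.
Qed.

Definition bcbessel_term (R : realType) (V Z : bicomplex R) (s : nat) :
    bicomplex R :=
  (-1) ^+ s * bcrgamma (V + s%:R + 1) / s`!%:R * bcpow (Z / 2) (V + (2 * s)%:R).

Definition bcbessel (R : realType) (V Z : bicomplex R) : bicomplex R :=
  lim (series (bcbessel_term V Z) @ \oo).

(* Main.v *)
(* In idempotent coordinates Z = z1 e1 + z2 e2 the defining series of J_V splits
   into the two classical Bessel series of integer orders l1 and l2 in z1 and
   z2.  Since Gamma (l + s + 1) = (l + s)!, the classical series is
     J_l z = (z / 2)^l * sum_s c_s ((z / 2)^2)^s   with   |c_s| <= 1 / s!,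
   a monomial times an entire power series composed with a monomial, hence it
   is complex differentiable everywhere.  Off the zero divisors the bicomplex
   difference quotient is the idempotent combination of the two complex
   difference quotients, so it converges. *)
Require Import Defs.
Set Warnings "-notation-overridden,-notation-incompatible-prefix,-ambiguous-paths".
From mathcomp Require Import all_boot all_order all_algebra.
From mathcomp Require Import all_classical all_reals all_analysis.
From mathcomp Require Import complex ring.
Import Order.TTheory GRing.Theory Num.Theory numFieldNormedType.Exports.
Set Implicit Arguments.
Unset Strict Implicit.
Local Open Scope classical_set_scope.
Local Open Scope ring_scope.
Local Open Scope complex_scope.

(** * Convergence of complex sequences and series *)

Lemma cvg_complex (R : realType) (T : Type) (F : set_system T) {FF : Filter F}
    (u v : T -> R) (a b : R) :
  u @ F --> a -> v @ F --> b ->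
  (fun t => u t +i* v t : R[i]^o) @ F --> (a +i* b : R[i]^o).
Proof.
move=> /cvgrPdist_lt ua /cvgrPdist_lt vb.
(* The radius is itself a complex number; being positive in the order of [R[i]] forces its imaginary
   part to be 0. *)
apply/cvgrPdist_lt => -[e i]; rewrite ltcE/= => /andP[/eqP -> e0].
have e20 : 0 < e / 2 by rewrite divr_gt0.
near=> t.
have -> : (a +i* b) - (u t +i* v t) = (a - u t)%:C + 'i%C * (b - v t)%:C.
  by rewrite [LHS]complexE.
apply: (le_lt_trans (ler_normD _ _)).
rewrite normrM !normc_def/= expr0n expr1n add0r !addr0 sqrtr1 mul1r.
rewrite !sqrtr_sqr -rmorphD -[e +i* 0]/(e%:C) ltcR [e]splitr ltrD//.
  by near: t; exact: ua.
by near: t; exact: vb.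
Unshelve. all: by end_near. Qed.

Lemma Re_sum (R : realType) (I : Type) (r : seq I) (P : pred I) (F : I -> R[i]) :
  complex.Re (\sum_(i <- r | P i) F i) = \sum_(i <- r | P i) complex.Re (F i).
Proof. by apply: big_morph => // -[a b] [c d]. Qed.

Lemma Im_sum (R : realType) (I : Type) (r : seq I) (P : pred I) (F : I -> R[i]) :
  complex.Im (\sum_(i <- r | P i) F i) = \sum_(i <- r | P i) complex.Im (F i).
Proof. by apply: big_morph => // -[a b] [c d]. Qed.

Lemma normc_ge_Im (R : realType) (x : R[i]) : `|complex.Im x|%:C <= `|x|.
Proof.
by rewrite normc_def lecR -sqrtr_sqr ler_wsqrtr // lerDr sqr_ge0.
Qed.

(** Real and imaginary parts are dominated by [v], hence their series converge absolutely in [R];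
    [cvg_complex] reassembles the two limits. *)
Lemma complex_series_cvg (R : realType) (u : nat -> R[i]) (v : nat -> R) :
  (forall n, `|u n| <= (v n)%:C) -> cvgn (series v) ->
  cvgn (series (u : nat -> R[i]^o)).
Proof.
move=> uv cv.
have v0 n : 0 <= v n.
  by rewrite -lecR; apply: le_trans (uv n); exact: normr_ge0.
have cR : cvgn (series (fun n => complex.Re (u n))).
  apply: (@normed_cvg _ R^o).
  apply: series_le_cvg cv => [n|//|n] /=; first exact: normr_ge0.
  by rewrite -lecR (le_trans (normc_ge_Re _)).
have cI : cvgn (series (fun n => complex.Im (u n))).
  apply: (@normed_cvg _ R^o).
  apply: series_le_cvg cv => [n|//|n] /=; first exact: normr_ge0.
  by rewrite -lecR (le_trans (normc_ge_Im _)).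
apply/cvg_ex; eexists.
rewrite (_ : series _ = fun n => (series (fun n => complex.Re (u n)) n +i*
    series (fun n => complex.Im (u n)) n : R[i]^o)); first exact: cvg_complex cR cI.
apply/funext => n; rewrite /series/= -Re_sum -Im_sum.
by case: (\sum_(0 <= k < n) u k).
Qed.

(** If [M < |l|], the norms would eventually exceed [M], which a proper filter excludes. The order
    of [K] is only partial; [0 <= M] makes [M] comparable with norms. *)
Lemma norm_lim_le (K : numFieldType) (V : normedModType K) (T : Type)
    (F : set_system T) {FF : ProperFilter F} (f : T -> V) (l : V) (M : K) :
  0 <= M -> f @ F --> l -> (\forall t \near F, `|f t| <= M) -> `|l| <= M.
Proof.
move=> M0 fl fM; rewrite real_leNgt ?ger0_real//; apply/negP => Ml.
have : \forall t \near F, False.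
  near=> t; have : `|f t| <= M by near: t.
  rewrite real_leNgt ?ger0_real// => /negP; apply.
  by near: t; apply: cvgr_norm_gt fl _ Ml.
by case/filter_ex.
Unshelve. all: by end_near. Qed.

Lemma exp_power_series_cvg (R : realType) (c : nat -> R[i]) (w : R[i]) :
  (forall s, `|c s| <= s`!%:R^-1) ->
  cvgn (series (fun s => c s * w ^+ s : R[i]^o)).
Proof.
move=> hc; apply: (@complex_series_cvg _ _ (exp_coeff (Normc.normc w))).
  move=> n; rewrite normrM normrX exp_coeffE rmorphM/= rmorphXn/=.
  rewrite fmorphV/= rmorph_nat; apply: ler_wpM2r => //.
exact: is_cvg_series_exp_coeff.
Qed.

(** The factor [z - w] is extracted twice: from [z^(n+2) - w^(n+2)], then from each difference of
    powers left once the tangent term is subtracted. *)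
Lemma exprn_diff2_le (K : numFieldType) (r z w : K) (n : nat) :
  `|z| <= r -> `|w| <= r ->
  `|z ^+ n.+2 - w ^+ n.+2 - (z - w) * (n.+2%:R * w ^+ n.+1)|
    <= `|z - w| ^+ 2 * ((n.+2 * n.+1)%:R * r ^+ n).
Proof.
move=> zr wr; have r0 : 0 <= r by apply: le_trans zr.
have bd1 m : `|z ^+ m.+1 - w ^+ m.+1| <= `|z - w| * (m.+1%:R * r ^+ m).
  rewrite subrXX normrM ler_wpM2l//.
  apply: (le_trans (ler_norm_sum _ _ _)).
  rewrite mulr_natl -[X in _ *+ X]card_ord -sumr_const; apply: ler_sum => i _.
  rewrite normrM !normrX -[X in r ^+ X](@subnK i) ?leq_ord// exprD.
  by apply: ler_pM => //; rewrite ?exprn_ge0// lerXn2r// nnegrE.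
have -> : z ^+ n.+2 - w ^+ n.+2 - (z - w) * (n.+2%:R * w ^+ n.+1) =
    (z - w) * \sum_(i < n.+2) (z ^+ (n.+1 - i) - w ^+ (n.+1 - i)) * w ^+ i.
  rewrite subrXX -mulrBr; congr (_ * _).
  rewrite mulr_natl -[X in _ *+ X]card_ord -sumr_const -sumrB.
  apply: eq_bigr => i _; rewrite mulrBl -exprD subnK ?leq_ord//.
rewrite normrM expr2 -mulrA ler_wpM2l//.
apply: (le_trans (ler_norm_sum _ _ _)).
have -> : `|z - w| * ((n.+2 * n.+1)%:R * r ^+ n) =
   \sum_(i < n.+2) `|z - w| * (n.+1%:R * r ^+ n).
  by rewrite sumr_const card_ord natrM -!mulrA -mulr_natl; ring.
apply: ler_sum => i _; rewrite normrM normrX.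
(* For [i = n+1] the remaining difference is [z^0 - w^0 = 0]; it is split off because [bd1] needs a
   positive exponent. *)
have [->|in1] := eqVneq (i : nat) n.+1.
  by rewrite subnn subrr normr0 mul0r !mulr_ge0// exprn_ge0.
have {in1}le_in : (i <= n)%N.
  by have := leq_ord i; rewrite leq_eqVlt (negbTE in1)/= ltnS.
rewrite subSn//.
apply: (@le_trans _ _ (`|z - w| * ((n - i).+1%:R * r ^+ (n - i)) * r ^+ i)).
  by apply: ler_pM => //; rewrite ?exprn_ge0// lerXn2r// nnegrE.
rewrite -!mulrA -exprD subnK// ler_wpM2l// ler_wpM2r ?exprn_ge0// ler_nat.
by rewrite ltnS leq_subr.
Qed.

(** * Complex logarithm and powers with natural exponents *)

Lemma normc_sqrt (R : realType) (z : R[i]) : Normc.normc z =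
   Num.sqrt (complex.Re z ^+ 2 + complex.Im z ^+ 2).
Proof. by case: z. Qed.

Lemma cexpD (R : realType) (z w : R[i]) : cexp (z + w) = cexp z * cexp w.
Proof.
case: z w => [a b] [c d]; rewrite /cexp/= expRD cosD sinD.
by apply/eqP; rewrite eq_complex/=; apply/andP; split; apply/eqP; ring.
Qed.

Lemma cexpMn (R : realType) (z : R[i]) (n : nat) :
  cexp (n%:R * z) = cexp z ^+ n.
Proof.
elim: n => [|n IH].
  by rewrite mul0r expr0 /cexp/= expR0 cos0 sin0 mulr1 mulr0.
by rewrite exprS -IH -cexpD -[n.+1]add1n natrD mulrDl mul1r.
Qed.

(** Polar form: with [r = |z|] and [t = acos (Re z / r)], [r cos t = Re z] and [r sin t = |Im z|];
    the sign chosen in [carg] turns [|Im z|] into [Im z]. *)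
Lemma clogK (R : realType) (z : R[i]) : z != 0 -> cexp (clog z) = z.
Proof.
move=> z0; have n0 : 0 < Normc.normc z.
  rewrite lt_neqAle; apply/andP; split.
    by rewrite eq_sym; apply: contra z0 => /eqP /Normc.eq0_normc ->.
  by rewrite -lecR; exact: (normr_ge0 z).
rewrite /cexp /clog/= lnK ?posrE//; set r := Normc.normc z in n0 *.
have r2 : r ^+ 2 = complex.Re z ^+ 2 + complex.Im z ^+ 2.
  by rewrite /r normc_sqrt sqr_sqrtr// addr_ge0 ?sqr_ge0.
have rn0 : r != 0 by rewrite gt_eqF.
have xr : -1 <= complex.Re z / r <= 1.
  rewrite -ler_norml normrM normfV (gtr0_norm n0) ler_pdivrMr// mul1r.
  rewrite -[leRHS](gtr0_norm n0) -[X in _ <= X]sqrtr_sqr -[leLHS]sqrtr_sqr.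
  by rewrite ler_wsqrtr// r2 lerDl sqr_ge0.
have s2 : r * sin (acos (complex.Re z / r)) = `|complex.Im z|.
  rewrite sin_acos// -[X in X * _](gtr0_norm n0) -sqrtr_sqr -sqrtrM ?sqr_ge0//.
  by rewrite mulrBr mulr1 -exprMn mulrCA divff// mulr1 r2 addrAC subrr add0r
    sqrtr_sqr.
have c2 : r * cos (acos (complex.Re z / r)) = complex.Re z.
  by rewrite acosK ?in_itv//= mulrCA divff// mulr1.
case: z @r n0 r2 rn0 xr s2 c2 {z0} => x y r n0 r2 rn0 xr /= s2 c2.
rewrite /carg/= -/r; case: ifPn => y0.
  by rewrite c2 s2 ger0_norm.
by rewrite cosN sinN c2 mulrN s2 ler0_norm ?opprK// ltW// ltNge.
Qed.

(** The choice of branch disappears for natural exponents: [exp (n log z) = (exp (log z))^n]. At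
    [z = 0] the convention [0 ^ 0 = 1] agrees with that of [^+]. *)
Lemma cpow_nat (R : realType) (z : R[i]) (n : nat) : cpow z n%:R = z ^+ n.
Proof.
rewrite /cpow; have [->|z0] := eqVneq z 0; first by rewrite expr0n pnatr_eq0.
by rewrite cexpMn clogK.
Qed.

(** * The Gamma function at positive integers *)

Lemma prod_natD_fact (K : comNzRingType) (m n : nat) :
  (\prod_(0 <= k < n) (m.+1%:R + k%:R) * m`!%:R = (m + n)`!%:R :> K).
Proof.
elim: n => [|n IH]; first by rewrite big_geq// mul1r addn0.
rewrite big_nat_recr//= -natrD addnS factS natrM -IH addSn.
by rewrite mulrAC mulrC.
Qed.

Lemma cvg_complex_natr_div (R : realType) (j : nat) :
  (fun n : nat => n%:R / (n.+1%:R + j%:R) : R[i]^o) @ \oo --> (1 : R[i]^o).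
Proof.
have h : (fun n : nat => n%:R / (n.+1%:R + j%:R) : R) @ \oo --> (1 : R).
  (* [n / (n+1+j) = 1 - (j+1) / (n+j+1)], and [harmonic (n+j)] is [1 / (n+j+1)]. *)
  rewrite (_ : (fun n : nat => _) =
      fun n => 1 - j.+1%:R * harmonic (n + j)%N :> R); last first.
    apply/funext => n; rewrite /harmonic/=.
    have -> : (n + j).+1%:R = n%:R + j%:R + 1 :> R by rewrite -natrD natr1.
    have : n%:R + j%:R + 1 != 0 :> R by rewrite -natrD natr1 pnatr_eq0.
    by rewrite -[n.+1%:R]natr1 -[j.+1%:R]natr1 => d; field.
  rewrite -[X in _ --> X]subr0 -(mulr0 j.+1%:R).
  apply: cvgB; first exact: cvg_cst.
  apply: cvgM; first exact: cvg_cst.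
  by rewrite cvg_shiftn; exact: cvg_harmonic.
rewrite (_ : (fun n : nat => _) =
    fun n => (n%:R / (n.+1%:R + j%:R)) +i* (0 : R)).
  exact: cvg_complex h (cvg_cst _).
by apply/funext => n; rewrite complexr0 rmorphM/= fmorphV rmorphD/= !rmorph_nat.
Qed.

(* The topology of R[i] is only found through R[i]^o, and unifying the rules for
   K : numFieldType with R[i]^o may diverge, so they are restated for K^o. *)
Lemma cvgM_regular (K : numFieldType) (T : Type) (F : set_system T)
    {FF : Filter F} (f g : T -> K^o) (a b : K^o) :
  f @ F --> a -> g @ F --> b -> (fun t => f t * g t : K^o) @ F --> (a * b : K^o).
Proof. exact: cvgM. Qed.

Lemma cvgM1_regular (K : numFieldType) (T : Type) (F : set_system T)
    {FF : Filter F} (f g : T -> K^o) (a : K^o) :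
  f @ F --> a -> g @ F --> (1 : K^o) -> (fun t => f t * g t : K^o) @ F --> a.
Proof. by move=> fa g1; rewrite -(mulr1 a); exact: cvgM. Qed.

(** At [m+1] the n-th Euler-Gauss quotient equals [m!] times the product of the [m+1] factors
    [n / (n+1+j)], each of which tends to 1. *)
Lemma cgamma_nat (R : realType) (m : nat) :
  cgamma (m.+1%:R : R[i]) = m`!%:R.
Proof.
apply: (@cvg_lim R[i]^o); first exact: norm_hausdorff.
have neq0 (p q : nat) : \prod_(0 <= k < q) (p.+1%:R + k%:R) != 0 :> R[i].
  by rewrite prodf_seq_neq0; apply/allP => k _; rewrite -natrD pnatr_eq0.
rewrite (_ : (fun n : nat => _) = fun n => m`!%:R *
    \prod_(0 <= j < m.+1) (n%:R / (n.+1%:R + j%:R)) : R[i]^o); last first.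
  apply/funext => n; rewrite cpow_nat big_split/= prodr_const_nat subn0.
  rewrite prodfV.
  (* [(m+n+1)!] is factored in two ways, once through [n!] and once through [m!]; this exchanges a
     product of [n+1] factors for one of [m+1] factors. *)
  have := prod_natD_fact (R[i]) n m.+1.
  rewrite addnS [in RHS]addnC -addnS -prod_natD_fact.
  have := neq0 m n.+1; have := neq0 n m.+1.
  move: (\prod_(0 <= k < m.+1) _) (\prod_(0 <= k < n.+1) _) => p q p0 q0 pq.
  have -> : n`!%:R = q * m`!%:R / p by rewrite -pq mulrAC divff ?mul1r.
  by field; rewrite p0 q0.
suff h : (fun n : nat => \prod_(0 <= j < m.+1) (n%:R / (n.+1%:R + j%:R)) : R[i]^o)
    @ \oo --> (1 : R[i]^o).
  by apply: cvgM1_regular h; exact: cvg_cst.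
elim: m.+1 => [|p IH].
  by under eq_fun do rewrite big_geq//; exact: cvg_cst.
under eq_fun do rewrite big_nat_recr//=.
by apply: cvgM1_regular IH _; exact: cvg_complex_natr_div.
Qed.

(** * Differentiation of power series *)

Lemma power_series_diff2_le (K : numFieldType) (c : nat -> K) (h : K -> K)
    (r z w L M : K) :
  (forall x, series (fun s => c s * x ^+ s : K) @ \oo --> h x) ->
  series (fun s => s.+1%:R * c s.+1 * w ^+ s) @ \oo --> L ->
  `|z| <= r -> `|w| <= r -> 0 <= M ->
  (forall n, \sum_(0 <= s < n) (s.+2 * s.+1)%:R * `|c s.+2| * r ^+ s <= M) ->
  `|h z - h w - (z - w) * L| <= `|z - w| ^+ 2 * M.
Proof.
move=> ch cL zr wr M0 hM.
(* The cut-offs [n+2] and [n+1] make the terms of order 0 and 1 cancel exactly, leaving [n]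
   second-order remainders. *)
pose D n := series (fun s => c s * z ^+ s) n.+2 -
  series (fun s => c s * w ^+ s) n.+2 -
  (z - w) * series (fun s => s.+1%:R * c s.+1 * w ^+ s) n.+1.
have DE n : D n = \sum_(0 <= s < n) c s.+2 *
    (z ^+ s.+2 - w ^+ s.+2 - (z - w) * (s.+2%:R * w ^+ s.+1)).
  rewrite /D /series/=.
  have recl2 (f : nat -> K) : \sum_(0 <= s < n.+2) f s =
      f 0%N + (f 1%N + \sum_(0 <= s < n) f s.+2) by rewrite !big_nat_recl.
  rewrite !recl2 big_nat_recl//.
  rewrite [RHS](eq_bigr (fun s => c s.+2 * z ^+ s.+2 - c s.+2 * w ^+ s.+2 -
     (z - w) * (s.+2%:R * c s.+2 * w ^+ s.+1))); last by move=> i _; ring.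
  rewrite !sumrB -mulr_sumr !expr0 !expr1; ring.
have cD : D @ \oo --> h z - h w - (z - w) * L.
  apply: cvgB; first apply: cvgB.
  - by have := ch z; rewrite -(cvg_shiftn 2); under eq_fun do rewrite addn2.
  - by have := ch w; rewrite -(cvg_shiftn 2); under eq_fun do rewrite addn2.
  - apply: cvgM; first exact: cvg_cst.
    by move: cL; rewrite -(cvg_shiftn 1); under eq_fun do rewrite addn1.
have r0 : 0 <= r by apply: le_trans zr.
(* It suffices to bound the partial sums, where [exprn_diff2_le] applies term by term. *)
apply: norm_lim_le cD _; first by rewrite mulr_ge0 ?exprn_ge0.
apply: nearW => n; rewrite DE (le_trans (ler_norm_sum _ _ _))//.
apply: le_trans (ler_wpM2l _ (hM n)); last by rewrite exprn_ge0.
rewrite mulr_sumr; apply: ler_sum => s _; rewrite normrM.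
apply: le_trans (ler_wpM2l _ (exprn_diff2_le _ zr wr)) _ => //.
by rewrite le_eqVlt; apply/orP; left; apply/eqP; ring.
Qed.

(** By the quadratic remainder estimate the difference quotient is within [|t| M] of [L]. The radius
    [|w| + 1] contains [t + w] as soon as [|t| <= 1]. *)
Lemma power_series_derivable (K : numFieldType) (c : nat -> K) (h : K -> K)
    (w L M : K) :
  (forall x, series (fun s => c s * x ^+ s : K) @ \oo --> h x) ->
  series (fun s => s.+1%:R * c s.+1 * w ^+ s) @ \oo --> L ->
  (forall n, \sum_(0 <= s < n) (s.+2 * s.+1)%:R * `|c s.+2| * (`|w| + 1) ^+ s
     <= M) ->
  derivable h w 1.
Proof.
move=> ch cL hM.
have M0 : 0 <= M by have := hM 0%N; rewrite big_geq.
apply/cvg_ex; exists L; apply/cvgrPdist_lt => e e0.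
(* [M] may be 0, so [e] is divided by [M + 1] instead. *)
have M1 : 0 < M + 1 by rewrite ltr_wpDl.
near=> t.
have t0 : t != 0 by near: t; exact: nbhs_dnbhs_neq.
have t1 : `|t| <= 1.
  by near: t; apply: dnbhs0_le.
have te : `|t| < e / (M + 1).
  by near: t; apply: dnbhs0_lt; rewrite divr_gt0.
have := @power_series_diff2_le K c h (`|w| + 1) (t + w) w L M ch cL _ _ M0 hM.
rewrite addrK [_ *: 1]mulr1 => H.
have {}H : `|h (t + w) - h w - t * L| <= `|t| ^+ 2 * M.
  apply: H; last by rewrite lerDl.
  by rewrite (le_trans (ler_normD _ _))// addrC lerD2l.
rewrite -[L](mulKf t0) distrC /= -[_ *: _]/(_ * _) -mulrBr normrM normfV.
rewrite ltr_pdivrMl ?normr_gt0//.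
rewrite (le_lt_trans H)// expr2 -mulrA ltr_pM2l ?normr_gt0//.
rewrite (@le_lt_trans _ _ (`|t| * (M + 1)))//.
  by rewrite ler_wpM2l// lerDl.
by rewrite -ltr_pdivlMr.
Unshelve. all: by end_near. Qed.

Lemma derivable_monomial_mul_comp (K : numFieldType) (h : K -> K) (l : nat) (z : K) :
  (forall w, derivable h w 1) ->
  derivable (fun z : K => (z / 2) ^+ l * h ((z / 2) ^+ 2)) z 1.
Proof.
move=> dh.
have dz2 n : derivable (fun z : K => (z / 2) ^+ n) z 1.
  rewrite (_ : (fun z => _) = (fun z : K => z * 2^-1) ^+ n :> (K -> K)).
    by apply: derivableX; apply: derivableM => //; exact: derivable_cst.
  by apply/funext => x; rewrite exprfctE.
apply: derivableM; first exact: dz2.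
apply/derivable1_diffP; apply: differentiable_comp; apply/derivable1_diffP => //.
Qed.

(** Substitution [t = z - z0], from the increment form in [derivable] to the quotient form used for
    bicomplex functions. *)
Lemma derivable_quotient_cvg (K : numFieldType) (g : K -> K) (z0 : K) :
  derivable g z0 1 -> exists L : K, (g z - g z0) / (z - z0) @[z --> z0^'] --> L.
Proof.
move=> /cvg_ex[L /cvgrPdist_lt gL]; exists L; apply/cvgrPdist_lt => e /gL.
rewrite /dnbhs !near_withinE => H.
have sub0 : z - z0 @[z --> z0] --> (0 : K).
  rewrite -(subrr z0).
  by refine (@cvgB K K^o K (nbhs z0) _ id (cst z0) z0 z0 _ _);
    [exact: cvg_id|exact: cvg_cst].
apply: (@filterS K (nbhs z0) _ _ _ _ (sub0 _ H)) => z /= {}H zz0.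
have /H : z - z0 != 0 by rewrite subr_eq0.
by rewrite /= [_ *: 1]mulr1 subrK -[_ *: _]/(_ * _) mulrC.
Qed.

Lemma sum_exp_coeff_le (R : realType) (x : R) (n : nat) :
  0 <= x -> \sum_(0 <= s < n) s`!%:R^-1 * x ^+ s <= expR x.
Proof.
move=> x0; rewrite [leLHS](_ : _ = series (exp_coeff x) n); last first.
  by rewrite /series/= exp_coeffE.
apply: nondecreasing_cvgn_le; last exact: is_cvg_series_exp_coeff.
by apply: nondecreasing_series => i _ _; exact: exp_coeff_ge0.
Qed.

(** Since [(s+1) / (s+1)! = 1 / s!], the bound on the coefficients is stable under formal
    differentiation. Hence the derived series converges, and the twice derived one is bounded at
    [|w| + 1] by [exp (|w| + 1)], which serves as [M]. *)
Lemma exp_power_series_derivable (R : realType) (c : nat -> R[i]) :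
  (forall s, `|c s| <= s`!%:R^-1) ->
  exists h : R[i] -> R[i],
    (forall w, series (fun s => c s * w ^+ s : R[i]^o) @ \oo --> (h w : R[i]^o)) /\
    (forall w, derivable (h : R[i]^o -> R[i]^o) w 1).
Proof.
move=> hc.
have fact_cancel s : s.+1%:R * (s.+1`!%:R^-1) = s`!%:R^-1 :> R[i].
  by rewrite factS natrM invfM mulrA divff ?mul1r ?pnatr_eq0.
have hc1 s : `|s.+1%:R * c s.+1| <= s`!%:R^-1.
  by rewrite normrM normr_nat -fact_cancel ler_wpM2l.
pose h (w : R[i]) : R[i] := lim (series (fun s => c s * w ^+ s : R[i]^o) @ \oo).
exists h; have ch w : series (fun s => c s * w ^+ s : R[i]^o) @ \oo --> (h w : R[i]^o).
  exact: exp_power_series_cvg.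
split=> [|w]; first exact: ch.
have /cvg_ex[L cL] := @exp_power_series_cvg R _ w hc1.
apply: (@power_series_derivable (R[i] : numFieldType) c h w L
  (expR (Normc.normc w + 1))%:C ch cL) => n.
have r0 : 0 <= Normc.normc w + 1.
  by rewrite addr_ge0// -lecR; exact: (normr_ge0 w).
have -> : `|w| + 1 = (Normc.normc w + 1)%:C by rewrite rmorphD.
apply: le_trans (_ : (\sum_(0 <= s < n) s`!%:R^-1 * (Normc.normc w + 1) ^+ s)%:C <= _).
  rewrite rmorph_sum/=; apply: ler_sum => s _.
  rewrite rmorphM/= rmorphXn/= fmorphV/= rmorph_nat.
  apply: ler_wpM2r; first by rewrite exprn_ge0// ler0c.
  by rewrite -fact_cancel mulnC natrM -mulrA ler_wpM2l// -fact_cancel ler_wpM2l.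
by rewrite lecR sum_exp_coeff_le.
Qed.

(** * Classical Bessel functions of natural order *)

Definition bessel_term (R : realType) (nu z : R[i]) (s : nat) : R[i] :=
  (-1) ^+ s * (cgamma (nu + s%:R + 1))^-1 / s`!%:R * cpow (z / 2) (nu + (2 * s)%:R).

Lemma bessel_term_nat (R : realType) (l s : nat) (z : R[i]) :
  bessel_term l%:R z s =
  (z / 2) ^+ l * ((-1) ^+ s / (l + s)`!%:R / s`!%:R * ((z / 2) ^+ 2) ^+ s).
Proof.
rewrite /bessel_term -!natrD natr1 cgamma_nat cpow_nat exprD exprM.
by rewrite mulrCA.
Qed.

Lemma bessel_nat_holomorphic (R : realType) (l : nat) :
  exists g : R[i] -> R[i],
    (forall z, series (bessel_term l%:R z : nat -> R[i]^o) @ \oo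
       --> (g z : R[i]^o)) /\
    (forall z0 : R[i]^o, exists L : R[i]^o,
       ((g z - g z0) / (z - z0) : R[i]^o) @[z --> z0^'] --> L).
Proof.
pose c s : R[i] := (-1) ^+ s / (l + s)`!%:R / s`!%:R.
(* The factor [1 / (l+s)!] is at most 1 and is discarded. *)
have hc s : `|c s| <= s`!%:R^-1.
  rewrite /c !normrM normrX normrN1 expr1n mul1r !normfV !normr_nat.
  rewrite ler_piMl ?invr_ge0// invf_le1 ?ltr0n ?fact_gt0// ler1n fact_gt0//.
have [h [ch dh]] := exp_power_series_derivable hc.
exists (fun z => (z / 2) ^+ l * h ((z / 2) ^+ 2)); split=> [z|z0].
  rewrite (_ : series _ = fun n => (z / 2) ^+ l *
      series (fun s => c s * ((z / 2) ^+ 2) ^+ s : R[i]^o) n : R[i]^o).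
    by apply: cvgM_regular; [exact: cvg_cst|exact: ch].
  apply/funext => n; rewrite /series/= mulr_sumr; apply: eq_bigr => s _.
  exact: bessel_term_nat.
apply: (@derivable_quotient_cvg (R[i] : numFieldType)).
exact: (@derivable_monomial_mul_comp (R[i] : numFieldType)).
Qed.

(** * Limits in idempotent coordinates *)

Lemma cvg_lincomb (K : numFieldType) (T : Type) (F : set_system T)
    {FF : Filter F} (x y : K) (u v : T -> K^o) (a b : K^o) :
  u @ F --> a -> v @ F --> b ->
  (fun t => x * u t + y * v t : K^o) @ F --> (x * a + y * b : K^o).
Proof.
move=> ua vb.
by apply: (@cvgD K K^o); apply: cvgM_regular => //; exact: cvg_cst.
Qed.

(** The topology is that of the pair [(bcl1, bcl2)], and both coordinates of [bcidem x y] are linear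
    in [x] and [y]. *)
Lemma cvg_bcidem (R : realType) (T : Type) (F : set_system T) {FF : Filter F}
    (u v : T -> R[i]^o) (a b : R[i]^o) :
  u @ F --> a -> v @ F --> b ->
  (fun t => bcidem (u t) (v t)) @ F --> bcidem a b.
Proof.
move=> ua vb.
have idemE (x y : R[i]) : bcidem x y =
    bc (2^-1 * x + 2^-1 * y) (- (2 * 'i%R)^-1 * x + (2 * 'i%R)^-1 * y).
  by rewrite bcidemE; congr bc; ring.
rewrite idemE (_ : (fun t => _) = fun t => bc (2^-1 * u t + 2^-1 * v t)
    (- (2 * 'i%R)^-1 * u t + (2 * 'i%R)^-1 * v t)); last first.
  by apply/funext => t; rewrite idemE.
have h1 := @cvg_lincomb _ _ _ FF 2^-1 2^-1 _ _ _ _ ua vb.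
have h2 := @cvg_lincomb _ _ _ FF (- (2 * 'i%R)^-1) (2 * 'i%R)^-1 _ _ _ _ ua vb.
exact: (@cvg_pair _ _ _ _ _ _ FF (nbhs_filter _) (nbhs_filter _) _ _ h1 h2).
Qed.

Lemma bcz1_continuous (R : realType) (Z0 : bicomplex R) :
  (fun Z => bcz1 Z : R[i]^o) @ Z0 --> (bcz1 Z0 : R[i]^o).
Proof.
have z1E (Z : bicomplex R) : bcz1 Z = 1 * Z.1 + (- 'i%R) * Z.2.
  by rewrite /bcz1 mul1r mulNr.
rewrite z1E (_ : (fun Z => _) = fun Z : bicomplex R => 1 * Z.1 + (- 'i%R) * Z.2).
  by apply: cvg_lincomb; [exact: cvg_fst|exact: cvg_snd].
by apply/funext => Z; rewrite z1E.
Qed.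

Lemma bcz2_continuous (R : realType) (Z0 : bicomplex R) :
  (fun Z => bcz2 Z : R[i]^o) @ Z0 --> (bcz2 Z0 : R[i]^o).
Proof.
have z2E (Z : bicomplex R) : bcz2 Z = 1 * Z.1 + 'i%R * Z.2.
  by rewrite /bcz2 mul1r.
rewrite z2E (_ : (fun Z => _) = fun Z : bicomplex R => 1 * Z.1 + 'i%R * Z.2).
  by apply: cvg_lincomb; [exact: cvg_fst|exact: cvg_snd].
by apply/funext => Z; rewrite z2E.
Qed.

(** Used with [f] an idempotent component and [D] the points whose increment is not a zero divisor:
    a limit over a punctured neighbourhood can then be composed with [f]. *)
Lemma cvg_within_dnbhs (T U : topologicalType) (f : T -> U) (x : T) (D : set T) :
  f @ x --> f x -> (forall y, D y -> f y != f x) ->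
  f @ within D (nbhs x) --> (f x)^'.
Proof.
move=> cf Df A /cf H.
have {}H : \forall y \near x, f y != f x -> A (f y) by exact: H.
apply: (@filterS T (nbhs x) _ _ _ _ H) => y Hy /Df; exact: Hy.
Qed.

(** * Algebra of the idempotent components *)

Section idempotent_morphisms.
Variable R : realType.
Implicit Types Z W : bicomplex R.

Lemma bcz1N Z : bcz1 (- Z) = - bcz1 Z.
Proof. by rewrite /bcz1 !bcE; ring. Qed.

Lemma bcz2N Z : bcz2 (- Z) = - bcz2 Z.
Proof. by rewrite /bcz2 !bcE; ring. Qed.

Lemma bcz1_1 : bcz1 (1 : bicomplex R) = 1.
Proof. by rewrite /bcz1 !bcE; ring. Qed.

Lemma bcz2_1 : bcz2 (1 : bicomplex R) = 1.
Proof. by rewrite /bcz2 !bcE; ring. Qed.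

Lemma bcz1_0 : bcz1 (0 : bicomplex R) = 0.
Proof. by rewrite -(subrr 1) bcz1D bcz1N subrr. Qed.

Lemma bcz2_0 : bcz2 (0 : bicomplex R) = 0.
Proof. by rewrite -(subrr 1) bcz2D bcz2N subrr. Qed.

Lemma bcz1_nat n : bcz1 (n%:R : bicomplex R) = n%:R.
Proof.
elim: n => [|n IH]; first by rewrite bcz1_0.
by rewrite -!natr1 bcz1D IH bcz1_1.
Qed.

Lemma bcz2_nat n : bcz2 (n%:R : bicomplex R) = n%:R.
Proof.
elim: n => [|n IH]; first by rewrite bcz2_0.
by rewrite -!natr1 bcz2D IH bcz2_1.
Qed.

Lemma bcz1X Z n : bcz1 (Z ^+ n) = bcz1 Z ^+ n.
Proof. by elim: n => [|n IH]; rewrite ?bcz1_1// !exprS bcz1M IH. Qed.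

Lemma bcz2X Z n : bcz2 (Z ^+ n) = bcz2 Z ^+ n.
Proof. by elim: n => [|n IH]; rewrite ?bcz2_1// !exprS bcz2M IH. Qed.

(** Both sides solve [z1 x = 1], with [z1] nonzero because [z1 z2] is. On zero divisors the ring
    inverse is the identity, hence the restriction. *)
Lemma bcz1V Z : bcnorm2 Z != 0 -> bcz1 Z^-1 = (bcz1 Z)^-1.
Proof.
move=> uZ; have z10 : bcz1 Z != 0.
  by apply: contra uZ => /eqP z0; rewrite bcnorm2E z0 mul0r.
by apply: (mulfI z10); rewrite -bcz1M divrr// bcz1_1 divff.
Qed.

Lemma bcz2V Z : bcnorm2 Z != 0 -> bcz2 Z^-1 = (bcz2 Z)^-1.
Proof.
move=> uZ; have z20 : bcz2 Z != 0.
  by apply: contra uZ => /eqP z0; rewrite bcnorm2E z0 mulr0.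
by apply: (mulfI z20); rewrite -bcz2M divrr// bcz2_1 divff.
Qed.

Lemma bcnorm2_nat_neq0 n : (0 < n)%N -> bcnorm2 (n%:R : bicomplex R) != 0.
Proof.
by move=> n0; rewrite bcnorm2E bcz1_nat bcz2_nat mulf_neq0// pnatr_eq0 -lt0n.
Qed.

Lemma bcz1_sum (I : Type) (r : seq I) (F : I -> bicomplex R) :
  bcz1 (\sum_(i <- r) F i) = \sum_(i <- r) bcz1 (F i).
Proof. exact: (big_morph _ (@bcz1D R) bcz1_0). Qed.

Lemma bcz2_sum (I : Type) (r : seq I) (F : I -> bicomplex R) :
  bcz2 (\sum_(i <- r) F i) = \sum_(i <- r) bcz2 (F i).
Proof. exact: (big_morph _ (@bcz2D R) bcz2_0). Qed.

(** [bcz1] is a ring morphism, and powers and [1 / Gamma] are defined by components. The only ring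
    divisions are by [s!] and 2, which are units. *)
Lemma bcz1_bessel_term V Z s :
  bcz1 (bcbessel_term V Z s) = bessel_term (bcz1 V) (bcz1 Z) s.
Proof.
rewrite /bcbessel_term /bessel_term !bcz1M bcz1X bcz1N bcz1_1 !bcidem_z1.
by rewrite !bcz1V ?bcnorm2_nat_neq0 ?fact_gt0// !bcz1D !bcz1M bcz1V
  ?bcnorm2_nat_neq0// !bcz1_nat ?bcz1_1.
Qed.

Lemma bcz2_bessel_term V Z s :
  bcz2 (bcbessel_term V Z s) = bessel_term (bcz2 V) (bcz2 Z) s.
Proof.
rewrite /bcbessel_term /bessel_term !bcz2M bcz2X bcz2N bcz2_1 !bcidem_z2.
by rewrite !bcz2V ?bcnorm2_nat_neq0 ?fact_gt0// !bcz2D !bcz2M bcz2V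
  ?bcnorm2_nat_neq0// !bcz2_nat ?bcz2_1.
Qed.

Lemma bcidem_quotient (a b c d : R[i]) Z W : bcnorm2 (Z - W) != 0 ->
  (bcidem a b - bcidem c d) / (Z - W) =
  bcidem ((a - c) / (bcz1 Z - bcz1 W)) ((b - d) / (bcz2 Z - bcz2 W)).
Proof.
move=> nZW.
(* The scalars on the right become components of the two combinations on the left, which are then
   generalized to arbitrary bicomplex numbers. *)
rewrite -{2}(bcidem_z1 a b) -{3}(bcidem_z2 a b).
rewrite -{2}(bcidem_z1 c d) -{3}(bcidem_z2 c d).
move: (bcidem a b) (bcidem c d) => A B.
rewrite -[LHS]bcidemK bcz1M bcz2M bcz1V// bcz2V//.
by rewrite !bcz1D !bcz2D !bcz1N !bcz2N.
Qed.

End idempotent_morphisms.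

(** * Bicomplex holomorphy from complex differentiability *)

Lemma bc_holomorphic_idem (R : realType) (g1 g2 : R[i] -> R[i]) :
  (forall z0 : R[i]^o, exists L : R[i]^o,
    ((g1 z - g1 z0) / (z - z0) : R[i]^o) @[z --> z0^'] --> L) ->
  (forall z0 : R[i]^o, exists L : R[i]^o,
    ((g2 z - g2 z0) / (z - z0) : R[i]^o) @[z --> z0^'] --> L) ->
  bc_holomorphic [set: bicomplex R] (fun Z => bcidem (g1 (bcz1 Z)) (g2 (bcz2 Z))).
Proof.
move=> h1 h2 Z0 _.
have [L1 {}h1] := h1 (bcz1 Z0); have [L2 {}h2] := h2 (bcz2 Z0).
exists (bcidem L1 L2).
set D := [set Z | _ /\ _].
have Dz Z : D Z -> bcnorm2 (Z - Z0) != 0 by move=> [_ nz]; apply/eqP.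
(* On [D] the first component stays away from its value at [Z0]: equality would make [Z - Z0] a zero
   divisor. *)
have c1 : (fun Z => bcz1 Z : R[i]^o) @ within D (nbhs Z0) --> (bcz1 Z0 : R[i]^o)^'.
  apply: cvg_within_dnbhs; first exact: bcz1_continuous.
  move=> Z /Dz; apply: contra => /eqP zz.
  by rewrite bcnorm2E bcz1D bcz1N zz subrr mul0r.
have c2 : (fun Z => bcz2 Z : R[i]^o) @ within D (nbhs Z0) --> (bcz2 Z0 : R[i]^o)^'.
  apply: cvg_within_dnbhs; first exact: bcz2_continuous.
  move=> Z /Dz; apply: contra => /eqP zz.
  by rewrite bcnorm2E bcz2D bcz2N zz subrr mulr0.
have FD : Filter (within D (nbhs Z0)) by exact: within_filter.
have := @cvg_bcidem R _ _ FD _ _ _ _ (cvg_comp _ _ c1 h1) (cvg_comp _ _ c2 h2).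
(* The bicomplex quotient and the combination of complex quotients agree on [D], so they have the
   same limit there. *)
apply: cvg_trans; apply: (@near_eq_cvg _ _ (within D (nbhs Z0))); near=> Z.
have /Dz nZ : D Z by near: Z; exact: withinT.
by rewrite bcidem_quotient.
Unshelve. all: by end_near. Qed.

Theorem theorem5p3 (R : realType) (l1 l2 : nat) (alpha1 alpha2 nu1 nu2 : R[i])
    (V : bicomplex R) :
  alpha1 = (l1%:R + l2%:R) / 2 ->
  alpha2 = (l2%:R - l1%:R) / (2 * 'i%R) ->
  V = bcC alpha1 + bcj R * bcC alpha2 ->
  V = bcC nu1 * bce1 R + bcC nu2 * bce2 R ->
  bc_holomorphic [set: bicomplex R] (bcbessel V).
Proof.
(* [alpha1] and [alpha2] are the coordinates that [bcidemE] gives for [l1 e1 + l2 e2]. *)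
move=> -> -> VE _; have {}VE : V = bcidem l1%:R l2%:R by rewrite VE bcjE bcidemE.
have [g1 [s1 h1]] := bessel_nat_holomorphic R l1.
have [g2 [s2 h2]] := bessel_nat_holomorphic R l2.
rewrite (_ : bcbessel V = fun Z => bcidem (g1 (bcz1 Z)) (g2 (bcz2 Z))).
  exact: bc_holomorphic_idem.
apply/funext => Z; apply: (@cvg_lim (bicomplex R)); first exact: norm_hausdorff.
(* The splitting holds already for partial sums, because the components are additive; [cvg_bcidem]
   then passes to the limit. *)
rewrite (_ : series _ = fun n =>
    bcidem (series (bessel_term l1%:R (bcz1 Z) : nat -> R[i]^o) n)
      (series (bessel_term l2%:R (bcz2 Z) : nat -> R[i]^o) n)).
  exact: cvg_bcidem.
apply/funext => n; rewrite -[LHS]bcidemK /series/= bcz1_sum bcz2_sum.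
by congr bcidem; apply: eq_bigr => s _;
  rewrite ?bcz1_bessel_term ?bcz2_bessel_term VE ?bcidem_z1 ?bcidem_z2.
Qed.
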